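(* Let $f\ge 1$ and $n\ge 5f-1$. The fast Byzantine consensus algorithm described in the context, run by $n$ processes of which at most $f$ are Byzantine, satisfies the consistency property of consensus: no two correct processes decide on different values.
   Context: Model. There are $n$ processes $\Pi=\{p_1,\dots,p_n\}$, at most $f$ of which are Byzantine (behave arbitrarily); the others are correct. Channels are reliable, authenticated and point-to-point; digital signatures $\mathrm{sign}_q(\cdot)$ of correct processes cannot be forged; the system is partially synchronous. Each process $p$ has an input value $x^{\mathrm{in}}_p$. Algorithm. Views: each process has a current view number, initially $1$, managed by a background view synchronization protocol; a correct process never decreases its view number and only sends messages associated with its current view. The leader of view $v$ is $\mathrm{leader}(v)=p_{(v \bmod n)+1}$. Proposing in view $v$: the leader $p$, having a value $\hat x$ and a progress certificate $\hat\sigma$ for $\hat x$ in view $v$, sends $\mathrm{propose}(\hat x,v,\hat\sigma,\hat\tau)$ to all, where $\hat\tau=\mathrm{sign}_p((\mathrm{propose},\hat x,v))$; a correct leader issues at most one proposal in its view. In view $1$ the leader uses $\hat x=x^{\mathrm{in}}_{\mathrm{leader}(1)}$ and $\hat\sigma=\bot$ (any value with certificate $\bot$ is considered certified in view 1). When a correct process receives a proposal for the first time in its current view $v$ from $\mathrm{leader}(v)$, and $\hat\sigma,\hat\tau$ are valid, it sets its local variable $\mathit{vote}$ to $(\hat x,v,\hat\sigma,\hat\tau)$ and then sends $\mathrm{ack}(\hat x,v)$ to every process. A process decides $\hat x$ (in view $v$) once it receives $\mathrm{ack}(\hat x,v)$ from $n-f$ processes. Votes: initially $\mathit{vote}=\mathit{nil}$.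 A vote is valid if it is $\mathit{nil}$ or it is $(x,u,\sigma,\tau)$ with $\sigma$ a valid progress certificate for $x$ in view $u$ and $\tau$ a valid signature of $\mathrm{leader}(u)$ on $(\mathrm{propose},x,u)$; the latter is a vote for value $x$ in view $u$. When a correct process $q$ changes its current view to $v$, it sends $(\mathit{vote}_q,\mathrm{sign}_q((\mathrm{vote},\mathit{vote}_q,v)))$ to $\mathrm{leader}(v)$. Selection (by the leader of view $v>1$): wait for valid votes from $n-f$ processes. If all are $\mathit{nil}$, select the leader's own input. Otherwise let $w$ be the highest view in a received valid vote. If only one value $x$ has a received valid vote in view $w$, select $x$. Otherwise $q=\mathrm{leader}(w)$ has provably equivocated; wait until valid votes from $n-f$ processes other than $q$ are received (restart the selection if $w$ is no longer the highest view), and let $\mathit{votes}'$ be these $n-f$ votes. If $\mathit{votes}'$ contains $2f$ valid votes for some value $x$ in view $w$, select $x$; otherwise any value may be selected and the leader selects its own input. Progress certificate (view $v>1$): the leader sends the collected votes and the selected value $\hat x$ to at least $2f+1$ processes. A correct process signs $(\mathrm{CertAck},\hat x,v)$ only after verifying, from the given signed votes, that $\hat x$ is a correct outcome of the selection algorithm (any value being accepted in the cases where the leader is to select its own input). A valid progress certificate for $\hat x$ in view $v>1$ is a set of $f+1$ signatures by distinct processes on $(\mathrm{CertAck},\hat x,v)$. *)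

(* Defs.v *)
From HB Require Import structures.
From mathcomp Require Import all_boot.
Set Implicit Arguments.
Unset Strict Implicit.
Unset Printing Implicit Defensive.

(* Fast Byzantine consensus among the processes 'I_n, as a transition system.
   Process p_i of the paper is the ordinal i - 1.  Signatures are symbolic:
   sign_q(m) is the term [Sign q m].  It determines q and m, so a pair
   (m, sign_q(m)) is represented by the signature alone, and checking a
   signature amounts to comparing its signer and content with the expected
   ones.  Unforgeability is the restriction [derivable] on the messages that
   Byzantine processes can send. *)

Section Messages.

Context {n : nat} {V : eqType}.

Record signature (M : Type) := Sign { signer : 'I_n; content : M }.

Definition pair_of_signature M (s : signature M) := (signer s, content s).
Definition signature_of_pair M (a : 'I_n * M) := Sign a.1 a.2.
Lemma pair_of_signatureK M :
  cancel (@pair_of_signature M) (@signature_of_pair M).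
Proof. by case. Qed.
HB.instance Definition _ (M : eqType) :=
  Equality.copy (signature M) (can_type (@pair_of_signatureK M)).

Inductive claim := Propose of V & nat | CertAck of V & nat.

Definition sum_of_claim (a : claim) : (V * nat) + (V * nat) :=
  match a with Propose x v => inl (x, v) | CertAck x v => inr (x, v) end.
Definition claim_of_sum (a : (V * nat) + (V * nat)) : claim :=
  match a with inl b => Propose b.1 b.2 | inr b => CertAck b.1 b.2 end.
Lemma sum_of_claimK : cancel sum_of_claim claim_of_sum.
Proof. by case. Qed.
HB.instance Definition _ := Equality.copy claim (can_type sum_of_claimK).

(* [None] is the certificate bottom of view 1. *)
Definition certificate := option (seq (signature claim)).

Record vote := Vote {
  vote_value : V;
  vote_view : nat;
  vote_cert : certificate;
  vote_sig : signature claim }.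

Definition tuple_of_vote (t : vote) :=
  (vote_value t, vote_view t, vote_cert t, vote_sig t).
Definition vote_of_tuple (a : V * nat * certificate * signature claim) :=
  let: (x, u, sg, tau) := a in Vote x u sg tau.
Lemma tuple_of_voteK : cancel tuple_of_vote vote_of_tuple.
Proof. by case. Qed.
HB.instance Definition _ := Equality.copy vote (can_type tuple_of_voteK).

(* sign_q((vote, vote_q, v)), where vote_q = [None] stands for nil. *)
Definition signed_vote := signature (option vote * nat)%type.

Inductive message :=
  | MPropose of V & nat & certificate & signature claim
  | MAck of V & nat
  | MVote of signed_vote
  | MCertReq of seq signed_vote & V & nat
  | MCertAck of signature claim.

Definition cert_sigs (sg : certificate) : seq (signature claim) :=
  if sg is Some s then s else [::].

Definition opt_vote_sigs (ot : option vote) : seq (signature claim) :=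
  if ot is Some t then vote_sig t :: cert_sigs (vote_cert t) else [::].

Definition message_claims (m : message) : seq (signature claim) :=
  match m with
  | MPropose _ _ sg tau => tau :: cert_sigs sg
  | MAck _ _ => [::]
  | MVote s => opt_vote_sigs (content s).1
  | MCertReq C _ _ => flatten [seq opt_vote_sigs (content s).1 | s <- C]
  | MCertAck s => [:: s]
  end.

Definition message_votes (m : message) : seq signed_vote :=
  match m with
  | MVote s => [:: s]
  | MCertReq C _ _ => C
  | _ => [::]
  end.

End Messages.

Arguments signature n M : clear implicits.
Arguments claim V : clear implicits.
Arguments certificate n V : clear implicits.
Arguments vote n V : clear implicits.
Arguments signed_vote n V : clear implicits.
Arguments message n V : clear implicits.

Section Validity.

Context {n : nat} (f : nat) {V : eqType}.

(* leader(v) is p_((v mod n) + 1), that is, the ordinal v mod n. *)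
Definition leads (p : 'I_n) (v : nat) : bool := val p == v %% n.

Definition valid_cert (sg : certificate n V) (x : V) (v : nat) : bool :=
  match sg with
  | None => v == 1
  | Some s => [&& 1 < v, size s == f.+1, uniq [seq signer t | t <- s]
                & all (fun t => content t == CertAck x v) s]
  end.

Definition valid_proposal_sig (tau : signature n (claim V)) (x : V) (v : nat) :=
  leads (signer tau) v && (content tau == Propose x v).

Definition valid_vote (ot : option (vote n V)) : bool :=
  if ot is Some t then
    valid_cert (vote_cert t) (vote_value t) (vote_view t)
    && valid_proposal_sig (vote_sig t) (vote_value t) (vote_view t)
  else true.

Definition votes_in (w : nat) (s : signed_vote n V) : bool :=
  if (content s).1 is Some t then vote_view t == w else false.

Definition votes_for (x : V) (w : nat) (s : signed_vote n V) : bool :=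
  if (content s).1 is Some t then (vote_value t == x) && (vote_view t == w)
  else false.

(* The collected votes C may contain several votes of a Byzantine process, so
   the processes are counted without repetition. *)
Definition valid_collection (v : nat) (C : seq (signed_vote n V)) : Prop :=
  {in C, forall s, (content s).2 = v /\ valid_vote (content s).1}
  /\ n - f <= #|[set q in [seq signer s | s <- C]]|.

Definition highest_view (C : seq (signed_vote n V)) (w : nat) : Prop :=
  has (votes_in w) C /\ forall u, has (votes_in u) C -> u <= w.

Definition equivocation (C : seq (signed_vote n V)) (w : nat) : Prop :=
  exists x y, [/\ x != y, has (votes_for x w) C & has (votes_for y w) C].

(* C' is the list votes' of n - f votes of processes other than leader(w). *)
Definition votes_without_leader (C C' : seq (signed_vote n V)) (w : nat) : Prop :=
  [/\ subseq C' C, size C' = n - f, uniq [seq signer s | s <- C']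
    & {in C', forall s, ~~ leads (signer s) w}].

(* Outcome [Some x]: x has to be selected.  Outcome [None]: any value may be
   selected.  C consists of all the votes received when the selection ends, so
   its highest view is the one obtained after the last restart. *)
Inductive selection (v : nat) (C : seq (signed_vote n V)) : option V -> Prop :=
  | SelNil of valid_collection v C
      & {in C, forall s, (content s).1 = None} :
      selection v C None
  | SelUnique w x of valid_collection v C & highest_view C w
      & has (votes_for x w) C
      & (forall y, has (votes_for y w) C -> y = x) :
      selection v C (Some x)
  | SelQuorum w C' x of valid_collection v C & highest_view C w
      & equivocation C w & votes_without_leader C C' w
      & 2 * f <= count (votes_for x w) C' :
      selection v C (Some x)
  | SelFree w C' of valid_collection v C & highest_view C w
      & equivocation C w & votes_without_leader C C' w
      & (forall x, count (votes_for x w) C' < 2 * f) :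
      selection v C None.

Definition correct_outcome (v : nat) (C : seq (signed_vote n V)) (x : V) : Prop :=
  selection v C (Some x) \/ selection v C None.

End Validity.

Section Algorithm.

Context {n : nat} (f : nat) {V : eqType}.
Context (byz : {set 'I_n}) (input : 'I_n -> V).

(* [accepted], [selected] and [proposed] refer to the current view: whether the
   process has acknowledged a proposal, the value it has selected as a leader,
   and whether it has issued its proposal as a leader. *)
Record local_state := LocalState {
  cur_view : nat;
  cur_vote : option (vote n V);
  accepted : bool;
  selected : option V;
  proposed : bool }.

(* [sent c p q m] ([received c p q m]): p has sent m to q (q has received m
   from p).  [signed_claims] and [signed_votes] contain the signatures that
   correct processes have issued.  The local state of a Byzantine process is
   meaningless. *)
Record config := Config {
  local : 'I_n -> local_state;
  sent : 'I_n -> 'I_n -> message n V -> Prop;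
  received : 'I_n -> 'I_n -> message n V -> Prop;
  signed_claims : signature n (claim V) -> Prop;
  signed_votes : signed_vote n V -> Prop }.

Definition init : config :=
  Config (fun _ => LocalState 1 None false None false)
    (fun _ _ _ => False) (fun _ _ _ => False) (fun _ => False) (fun _ => False).

Definition set_local (c : config) (p : 'I_n) (l : local_state) : config :=
  Config (fun q => if q == p then l else local c q)
    (sent c) (received c) (signed_claims c) (signed_votes c).

Definition send (c : config) (p : 'I_n) (dst : pred 'I_n) (m : message n V) :=
  Config (local c)
    (fun p' q' m' => sent c p' q' m' \/ [/\ p' = p, dst q' & m' = m])
    (received c) (signed_claims c) (signed_votes c).

Definition deliver (c : config) (p q : 'I_n) (m : message n V) : config :=
  Config (local c) (sent c)
    (fun p' q' m' => received c p' q' m' \/ [/\ p' = p, q' = q & m' = m])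
    (signed_claims c) (signed_votes c).

Definition sign_claim (c : config) (s : signature n (claim V)) : config :=
  Config (local c) (sent c) (received c)
    (fun s' => signed_claims c s' \/ s' = s) (signed_votes c).

Definition sign_vote (c : config) (s : signed_vote n V) : config :=
  Config (local c) (sent c) (received c) (signed_claims c)
    (fun s' => signed_votes c s' \/ s' = s).

Definition derivable (c : config) (m : message n V) : Prop :=
  {in message_claims m, forall s, signer s \in byz \/ signed_claims c s}
  /\ {in message_votes m, forall s, signer s \in byz \/ signed_votes c s}.

Definition issue_proposal (c : config) (p : 'I_n) (x : V)
    (sg : certificate n V) : config :=
  let l := local c p in
  let v := cur_view l in
  let tau := Sign p (Propose x v) in
  send
    (sign_claim
      (set_local c p
        (LocalState v (cur_vote l) (accepted l) (selected l) true)) tau)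
    p predT (MPropose x v sg tau).

Inductive step (c : config) : config -> Prop :=
  | StepByzantine p q m of p \in byz & derivable c m :
      step c (send c p (pred1 q) m)
  | StepDeliver p q m of sent c p q m :
      step c (deliver c p q m)
  | StepEnterView p v of p \notin byz & cur_view (local c p) < v :
      let ot := cur_vote (local c p) in
      let s := Sign p (ot, v) in
      step c
        (send
          (sign_vote (set_local c p (LocalState v ot false None false)) s)
          p (fun q => leads q v) (MVote s))
  | StepProposeFirst p of p \notin byz & leads p 1
      & cur_view (local c p) = 1 & ~~ proposed (local c p) :
      step c (issue_proposal c p (input p) None)
  | StepSelect p v C o (Q : {set 'I_n}) of p \notin byz & leads p v & 1 < v
      & cur_view (local c p) = v & selected (local c p) = None
      & {in C, forall s, received c (signer s) p (MVote s)}
      & selection f v C o & 2 * f + 1 <= #|Q| :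
      let l := local c p in
      let x := odflt (input p) o in
      step c
        (send
          (set_local c p
            (LocalState v (cur_vote l) (accepted l) (Some x) (proposed l)))
          p (mem Q) (MCertReq C x v))
  | StepCertAck p r v C x of p \notin byz & leads r v & 1 < v
      & cur_view (local c p) = v & received c r p (MCertReq C x v)
      & correct_outcome f v C x :
      let s := Sign p (CertAck x v) in
      step c (send (sign_claim c s) p (pred1 r) (MCertAck s))
  | StepPropose p v x s of p \notin byz & leads p v & 1 < v
      & cur_view (local c p) = v & ~~ proposed (local c p)
      & selected (local c p) = Some x
      & {in s, forall t, received c (signer t) p (MCertAck t)}
      & valid_cert f (Some s) x v :
      step c (issue_proposal c p x (Some s))
  | StepAccept p r v x sg tau of p \notin byz & leads r v
      & cur_view (local c p) = v & ~~ accepted (local c p)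
      & received c r p (MPropose x v sg tau)
      & valid_cert f sg x v & valid_proposal_sig tau x v :
      let l := local c p in
      step c
        (send
          (set_local c p
            (LocalState v (Some (Vote x v sg tau)) true (selected l) (proposed l)))
          p predT (MAck x v)).

Inductive reachable : config -> Prop :=
  | ReachInit : reachable init
  | ReachStep c c' of reachable c & step c c' : reachable c'.

(* What p has received only grows, so this persists along an execution. *)
Definition decides (c : config) (p : 'I_n) (x : V) : Prop :=
  exists (v : nat) (Q : {set 'I_n}),
    n - f <= #|Q| /\ {in Q, forall q, received c q p (MAck x v)}.

(* Every decision of an execution is visible in its later configurations, so
   comparing decisions within one configuration loses nothing. *)
Definition consistency : Prop :=
  forall c : config, reachable c ->
  forall (p q : 'I_n) (x y : V), p \notin byz -> q \notin byz ->
  decides c p x -> decides c q y -> x = y.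

End Algorithm.

(* Main.v *)
Require Import Defs.
From mathcomp Require Import all_boot.
From mathcomp Require Import zify.

(* If n - f processes acknowledge x in view v, then every certificate for a
   later view is for x.  A correct process signs such a certificate only after
   seeing votes from n - f processes; the correct acknowledgers of x among them
   vote for x, in view v or later, and votes in views above v carry certificates,
   which are for x by induction on time.  So x can only be missed if v is the highest
   view and two values are voted for in it.  Then leader(v) is Byzantine, and of
   n - f votes from other processes at least n - f - f - (f - 1) >= 2f are for x,
   leaving at most 2f - 1 for any other value. *)

Set Implicit Arguments.
Unset Strict Implicit.
Unset Printing Implicit Defensive.

(** * Quorum intersection and correct signers *)

Section Quorums.

Context {n : nat} (f : nat) {V : eqType} (byz : {set 'I_n}).
Context (hf : 1 <= f) (hn : 5 * f - 1 <= n) (hbyz : #|byz| <= f).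

Lemma card_quorumC (Q : {set 'I_n}) : n - f <= #|Q| -> #|~: Q| <= f.
Proof. by have := cardsC Q; rewrite card_ord; lia. Qed.

(** The complement of [Q] and the Byzantine processes number at most [2 * f], fewer than the
    [4 * f - 1] processes that [S] has at least. *)
Lemma quorums_meet_correct (Q S : {set 'I_n}) :
  n - f <= #|Q| -> n - f <= #|S| ->
  exists q, [/\ q \in Q, q \in S & q \notin byz].
Proof.
move=> hQ hS; have /subsetPn [q qS] : ~~ (S \subset ~: Q :|: byz).
  apply/negP=> /subset_leq_card.
  by have := (leq_card_setU (~: Q) byz).1; have := card_quorumC hQ; lia.
by rewrite !inE negb_or negbK => /andP [qQ qb]; exists q.
Qed.

Lemma cert_correct_signer (s : seq (signature n (claim V))) x v :
  valid_cert f (Some s) x v ->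
  exists2 q, q \notin byz & Sign q (CertAck x v) \in s.
Proof.
case/and4P=> _ /eqP ss us /allP as_.
have [/hasP [t ts tb]|/hasPn no] :=
  boolP (has (fun t => signer t \notin byz) s).
  exists (signer t) => //; move/eqP: (as_ _ ts) => <-.
  by case: t ts {tb} => a b.
suff : f.+1 <= #|byz| by move/leq_trans/(_ hbyz); rewrite ltnn.
rewrite -ss -(size_map (@signer n _)) cardE; apply: uniq_leq_size => // q.
by case/mapP=> t ts ->; rewrite mem_enum; have := no t ts; rewrite negbK.
Qed.

(* The invariant linking a vote to an earlier acknowledgement of [x] in view
   [v]: later acknowledgements may only raise the view of the vote. *)
Definition remembers (x : V) (v : nat) (ot : option (vote n V)) : Prop :=
  if ot is Some t then v <= vote_view t /\ (vote_view t = v -> vote_value t = x)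
  else False.

Lemma votes_forP (x : V) w (s : signed_vote n V) :
  reflect (exists t, [/\ (content s).1 = Some t, vote_value t = x
                       & vote_view t = w])
    (votes_for x w s).
Proof.
rewrite /votes_for; case: (content s).1 => [t|]; last by right=> -[t []].
apply: (iffP andP) => [[/eqP <- /eqP <-]|[t' [[<-] -> ->]]]; last by rewrite !eqxx.
by exists t.
Qed.

(** * Selection after a quorum has acknowledged [x] *)

Section LockedSelection.

Context (x : V) (v w : nat) (C : seq (signed_vote n V)) (Q : {set 'I_n}).
Context (hQ : n - f <= #|Q|).
Context (later : {in C, forall s, forall t,
  (content s).1 = Some t -> v < vote_view t -> vote_value t = x}).
Context (ackers : {in C, forall s, signer s \in Q -> signer s \notin byz ->
  remembers x v (content s).1}).

Lemma locked_vote : valid_collection f w C ->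
  exists2 s, s \in C & remembers x v (content s).1.
Proof.
case=> _ /(quorums_meet_correct hQ) [q [qQ]]; rewrite inE => /mapP [s sC qs] qb.
by exists s => //; apply: ackers => //; rewrite -qs.
Qed.

Lemma locked_highest_view w0 :
  valid_collection f w C -> highest_view C w0 -> v <= w0.
Proof.
move=> /locked_vote [s sC]; case E: (content s).1 => [t|] //= [vt _] [_ hw].
apply: leq_trans vt (hw _ _); apply/hasP; exists s => //.
by rewrite /votes_in E.
Qed.

Lemma locked_later_view w0 y : v < w0 -> has (votes_for y w0) C -> y = x.
Proof.
move=> vw /hasP [s sC /votes_forP [t [st <- tw]]].
by apply: later st _ => //; rewrite tw.
Qed.

Lemma acker_votes_for s : highest_view C v -> s \in C -> signer s \in Q ->
  signer s \notin byz -> votes_for x v s.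
Proof.
move=> [_ hv] sC sQ sb; have := ackers sC sQ sb.
case E: (content s).1 => [t|] //= [vt tx].
have tv : vote_view t = v.
  apply/eqP; rewrite eqn_leq vt andbT; apply: hv; apply/hasP.
  by exists s => //; rewrite /votes_in E.
by apply/votes_forP; exists t; split=> //; apply: tx.
Qed.

(* Excluding the equivocating leader, which is Byzantine, at most [f - 1]
   Byzantine processes and [f] processes outside [Q] contribute to [C']. *)
Lemma dissenters_le C' l : highest_view C v ->
  votes_without_leader f C C' v -> l \in byz -> leads l v ->
  count (predC (votes_for x v)) C' <= 2 * f - 1.
Proof.
move=> hv [/mem_subseq subC _ uC' noL] lb lv.
have le : count (predC (votes_for x v)) C' <= #|~: Q :|: byz :\ l|.
  rewrite -size_filter -(size_map (@signer n _)) cardE; apply: uniq_leq_size.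
    by apply: subseq_uniq uC'; apply/map_subseq/filter_subseq.
  move=> q /mapP [s]; rewrite mem_filter => /andP [bs sC'] ->.
  rewrite mem_enum !inE; have [sQ|] //= := boolP (signer s \in Q).
  apply/andP; split; first by apply: contraNneq (noL s sC') => ->.
  by apply: contraNT bs; apply: acker_votes_for => //; apply: subC.
have := cardsD1 l byz; rewrite lb; have := card_quorumC hQ.
by have := (leq_card_setU (~: Q) (byz :\ l)).1; lia.
Qed.

(** Above [v] all votes are for [x], so conflicting values can only occur in [v] itself. *)
Lemma locked_equivocation w0 :
  (equivocation C v -> exists2 l, l \in byz & leads l v) ->
  valid_collection f w C -> highest_view C w0 -> equivocation C w0 ->
  w0 = v /\ exists2 l, l \in byz & leads l v.
Proof.
move=> byz_leader hC hw eq0.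
have := locked_highest_view hC hw; rewrite leq_eqVlt => /orP [/eqP vw|vw].
  by subst w0; split=> //; apply: byz_leader.
case: eq0 => a [b [/eqP ab ha hb]]; case: ab.
by rewrite (locked_later_view vw ha) (locked_later_view vw hb).
Qed.

Lemma locked_selection o :
  (equivocation C v -> exists2 l, l \in byz & leads l v) ->
  selection f w C o -> o = Some x.
Proof.
move=> byz_leader [hC nils|w0 y hC hw hy uy|w0 C' y hC hw eq0 hC' cy
                  |w0 C' hC hw eq0 hC' cx].
- by have [s sC] := locked_vote hC; rewrite nils.
- have := locked_highest_view hC hw; rewrite leq_eqVlt => /orP [/eqP vw|vw].
    (* A correct process of [Q] has a vote for [x] among those collected, so the unique value is
       [x]. *)
    subst w0; move: hC => [_ /(quorums_meet_correct hQ) [q [qQ]]].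
    rewrite inE => /mapP [s sC qs] qb; congr Some; apply/esym/uy/hasP.
    by exists s => //; rewrite qs in qQ qb; apply: acker_votes_for.
  by congr Some; apply: locked_later_view hy.
- have [vw [l lb lv]] := locked_equivocation byz_leader hC hw eq0; subst w0.
  have le := dissenters_le hw hC' lb lv; congr Some; apply/eqP/negPn/negP=> yx.
  (* Votes for [y] are dissenting, so there would be at most [2 * f - 1] of them. *)
  suff : count (votes_for y v) C' <= count (predC (votes_for x v)) C' by lia.
  apply: sub_count => s /votes_forP [t [st ty _]] /=.
  apply/votes_forP=> -[t' []]; rewrite st => -[<-] tx.
  by rewrite -ty tx eqxx in yx.
- have [vw [l lb lv]] := locked_equivocation byz_leader hC hw eq0; subst w0.
  (* [C'] has [n - f >= 4 * f - 1] votes; without the at most [2 * f - 1] dissenting ones, at least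
     [2 * f] are left for [x]. The bound on [n] is used in full here. *)
  have := dissenters_le hw hC' lb lv; have := cx x.
  have := count_predC (votes_for x v) C'; case: hC' => _ -> _ _.
  by lia.
Qed.

End LockedSelection.
End Quorums.

(** * Effects of a single step *)

Section Executions.

Context {n : nat} (f : nat) {V : eqType}.
Context (byz : {set 'I_n}) (input : 'I_n -> V).
Notation step := (step f byz input).
Notation reachable := (reachable f byz input).

Definition acked (c : @config n V) q x v := exists r, sent c q r (MAck x v).

Lemma step_signed_claims c c' s :
  step c c' -> signed_claims c s -> signed_claims c' s.
Proof. by case=> //= *; left. Qed.

Lemma step_signed_votes c c' s :
  step c c' -> signed_votes c s -> signed_votes c' s.
Proof. by case=> //= *; left. Qed.

Lemma step_sent c c' p q m : step c c' -> sent c p q m -> sent c' p q m.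
Proof. by case=> //= *; left. Qed.

Lemma step_received c c' p q m : step c c' -> received c' p q m ->
  received c p q m \/ sent c p q m.
Proof.
case=> //=; try by [move=> *; left].
by move=> p' q' m' snt [|[-> -> ->]]; [left | right].
Qed.

(** Entering a view clears both flags, so they are monotone only while the view stays the same. *)
Lemma step_local c c' q : step c c' ->
  cur_view (local c q) < cur_view (local c' q) \/
  [/\ cur_view (local c' q) = cur_view (local c q),
      accepted (local c q) -> accepted (local c' q)
    & proposed (local c q) -> proposed (local c' q)].
Proof.
case=> //=; intros; rewrite /=; try case: eqP => [->|_] /=;
  by [left | right; split].
Qed.

Lemma step_vote c c' q : step c c' ->
  cur_vote (local c' q) = cur_vote (local c q) \/
  exists x sg tau r,
    [/\ cur_vote (local c' q) = Some (Vote x (cur_view (local c q)) sg tau),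
        ~~ accepted (local c q)
      & received c r q (MPropose x (cur_view (local c q)) sg tau)].
Proof.
case=> //=; try by [move=> *; left; case: eqP => [->|] | move=> *; left].
move=> p r v x sg tau _ _ vp acc rcv _ _; case: eqP => [->|]; last by left.
by right; exists x, sg, tau, r; rewrite vp.
Qed.

Lemma step_ack c c' q r x v : step c c' -> q \notin byz ->
  sent c' q r (MAck x v) -> sent c q r (MAck x v) \/
  [/\ cur_view (local c q) = v, ~~ accepted (local c q), 0 < v,
      cur_view (local c' q) = v /\ accepted (local c' q)
    & exists sg tau r', [/\ cur_vote (local c' q) = Some (Vote x v sg tau),
        valid_cert f sg x v & received c r' q (MPropose x v sg tau)]].
Proof.
case=> /=; try by [move=> *; intuition congruence].
- by move=> p q' m pb _ qb [|[qp _ _]]; [left | rewrite -qp (negPf qb) in pb].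
- by move=> p v' _ _ _ [|[_ _ //]]; left.
- by move=> p _ _ _ _ _ [|[_ _ //]]; left.
- by move=> p v' C o Q _ _ _ _ _ _ _ _ _ [|[_ _ //]]; left.
- by move=> p r' v' C x' _ _ _ _ _ _ _ [|[_ _ //]]; left.
- by move=> p v' x' s _ _ _ _ _ _ _ _ _ [|[_ _ //]]; left.
move=> p r' v' x' sg tau _ _ vp acc rcv hsg _ _ [|[-> _ [-> ->]]]; first by left.
right; rewrite eqxx; split=> //; last by exists sg, tau, r'.
(* View 0 has no valid certificate: bottom needs view 1, and signatures need a later view. *)
by case: sg hsg {rcv} => [s /and4P [/ltnW]|/eqP ->].
Qed.

Lemma step_signed_vote c c' q ot w : step c c' ->
  signed_votes c' (Sign q (ot, w)) -> signed_votes c (Sign q (ot, w)) \/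
  [/\ ot = cur_vote (local c q), cur_view (local c q) < w
    & cur_view (local c' q) = w].
Proof.
case=> /=; try by [move=> *; left].
move=> p v _ lt [|[-> -> ->]]; first by left.
by right; rewrite eqxx.
Qed.

Lemma step_propose_claim c c' q x v : step c c' ->
  signed_claims c' (Sign q (Propose x v)) ->
  signed_claims c (Sign q (Propose x v)) \/
  [/\ cur_view (local c q) = v, ~~ proposed (local c q),
      cur_view (local c' q) = v, proposed (local c' q)
    & forall y, signed_claims c' (Sign q (Propose y v)) ->
        signed_claims c (Sign q (Propose y v)) \/ y = x].
Proof.
case=> /=; try by [move=> *; left].
- move=> p _ _ v1 np [|[-> -> ->]]; first by left.
  by right; rewrite eqxx; split=> // y [|[->]]; [left | right].
- by move=> p r v' C x' _ _ _ _ _ _ [|//]; left.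
- move=> p v' x' s _ _ _ v1 np _ _ _ [|[-> -> ->]]; first by left.
  by right; rewrite eqxx; split=> // y [|[->]]; [left | right].
Qed.

Lemma step_cert_ack c c' q x v : step c c' ->
  signed_claims c' (Sign q (CertAck x v)) ->
  signed_claims c (Sign q (CertAck x v)) \/
  exists r C, [/\ 1 < v, received c r q (MCertReq C x v)
                & correct_outcome f v C x].
Proof.
case=> /=; try by [move=> *; left].
- by move=> p _ _ _ _ [|//]; left.
- move=> p r v' C x' _ _ lt _ rcv sel [|[-> -> ->]]; first by left.
  by right; exists r, C.
- by move=> p v' x' s _ _ _ _ _ _ _ _ [|//]; left.
Qed.

(** * Unforgeability along executions *)

Definition genuine (c : @config n V) (s : seq (signature n (claim V))) : Prop :=
  {in s, forall t, signer t \in byz \/ signed_claims c t}.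

Lemma step_genuine c c' s : step c c' -> genuine c s -> genuine c' s.
Proof.
by move=> st gs t /gs [|/(step_signed_claims st)]; [left | right].
Qed.

Lemma step_derivable c c' m : step c c' -> derivable byz c m ->
  derivable byz c' m.
Proof.
move=> st [gm vm]; split; first exact: step_genuine st gm.
by move=> s /vm [|/(step_signed_votes st)]; [left | right].
Qed.

(** The three facts need a joint induction: stored votes come from received proposals and are
    themselves sent on at view changes. *)
Record authentic (c : @config n V) : Prop := Authentic {
  auth_received : forall p q m, received c p q m -> sent c p q m;
  auth_sent : forall p q m, sent c p q m -> derivable byz c m;
  auth_vote : forall p, genuine c (opt_vote_sigs (cur_vote (local c p))) }.

Lemma step_authentic c c' : step c c' -> authentic c -> authentic c'.
Proof.
move=> st [rcv snt vot].
have rcv' p q m : received c p q m -> derivable byz c m by move=> /rcv /snt.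
split.
- by move=> p q m /(step_received st) [/rcv|]; apply: step_sent.
- have old p q m : sent c p q m -> derivable byz c' m.
    by move=> /snt; apply: step_derivable.
  have mono m := step_derivable (m := m) st.
  case: st mono old => /=; try by [move=> *; eauto].
  + by move=> p q m _ dm mono old p' q' m' [/old|[_ _ ->]] //; apply: mono.
  + move=> p v _ lt mono old p' q' m' [/old //|[_ _ ->]]; split => /=.
      by move=> t /vot.
    by move=> t; rewrite inE => /eqP ->; right; right.
  + move=> p _ _ v1 _ mono old p' q' m' [/old //|[_ _ ->]]; split => //= t.
    by rewrite inE => /eqP ->; right; right.
  + move=> p v C o Q _ _ _ _ _ hC _ _ mono old p' q' m' [/old //|[_ _ ->]].
    split => /= t.
      by case/flattenP=> s /mapP [u /hC /rcv' [gu _] ->]; apply: gu.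
    by move=> /hC /rcv' [_ gu]; apply: gu; rewrite inE.
  + move=> p r v C x _ _ _ _ _ _ mono old p' q' m' [/old //|[_ _ ->]].
    by split => //= t; rewrite inE => /eqP ->; right; right.
  + move=> p v x s _ _ _ _ _ _ hs _ mono old p' q' m' [/old //|[_ _ ->]].
    split => //= t; rewrite inE => /orP [/eqP ->|]; first by right; right.
    move=> /hs /rcv' [gt _]; have := gt t; rewrite inE eqxx.
    by case=> //; [left | right; left].
  + by move=> p r v x sg tau _ _ _ _ _ _ _ mono old p' q' m' [/old //|[_ _ ->]].
- move=> p; have [->|[x [sg [tau [r [-> _ /rcv' [g _]]]]]]] := step_vote p st.
    exact: step_genuine st (vot p).
  exact: step_genuine st g.
Qed.

Lemma reachable_authentic c : reachable c -> authentic c.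
Proof.
elim=> [|c1 c2 _ IH st]; first by split.
exact: step_authentic st IH.
Qed.

(** * Proposals, acknowledgements and votes of correct processes *)

Lemma reachable_propose c p x v : reachable c ->
  signed_claims c (Sign p (Propose x v)) ->
  v <= cur_view (local c p) /\ (v = cur_view (local c p) -> proposed (local c p)).
Proof.
move=> rc; elim: rc x v => [//|c1 c2 _ IH st] x v.
case/(step_propose_claim st) => [/IH [le pr]|[_ _ <- ->]] //.
have [lt|[-> _ mono]] := step_local p st; last by split=> // /pr /mono.
by split; lia.
Qed.

(** A proposal first signed now requires [proposed] to be unset, which excludes an older one in the
    same view. *)
Lemma reachable_propose_inj c p x y v : reachable c ->
  signed_claims c (Sign p (Propose x v)) ->
  signed_claims c (Sign p (Propose y v)) -> x = y.
Proof.
move=> rc; elim: rc x y v => [//|c1 c2 rc1 IH st] x y v hx hy.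
have fresh z : cur_view (local c1 p) = v -> ~~ proposed (local c1 p) ->
    ~ signed_claims c1 (Sign p (Propose z v)).
  by move=> pv np /(reachable_propose rc1) [_]; rewrite pv (negPf np) => /(_ erefl).
have [ox|[pv np _ _ new]] := step_propose_claim st hx; last first.
  by have [/(fresh y pv np)|] := new y hy.
have [oy|[pv np _ _ new]] := step_propose_claim st hy; first exact: IH ox oy.
by case: (fresh x pv np ox).
Qed.

Lemma reachable_ack c q x v : reachable c -> q \notin byz -> acked c q x v ->
  [/\ 0 < v, v <= cur_view (local c q),
      v = cur_view (local c q) -> accepted (local c q)
    & remembers x v (cur_vote (local c q))].
Proof.
move=> rc qb; elim: rc x v => [|c1 c2 _ IH st] x v [r]; first by case.
case/(step_ack st qb) => [old|[_ _ v0 [-> ->] [sg [tau [r' [-> _ _]]]]]] //.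
have [v0 le acc rem] := IH _ _ (ex_intro _ r old); split=> //.
- by case: (step_local q st) => [|[->]]; lia.
- by case: (step_local q st) => [|[-> mono _ /acc /mono //]]; lia.
- have [-> //|[y [sg [tau [_ [-> na _]]]]]] := step_vote q st.
  (* By the induction hypothesis [accepted] is set if the process is still in [v], so a newly
     accepted proposal belongs to a later view. *)
  have lt : v < cur_view (local c1 q).
    by rewrite ltn_neqAle le andbT; apply: contraNneq na.
  by split=> /=; lia.
Qed.

Lemma reachable_ack_inj c q x y v : reachable c -> q \notin byz ->
  acked c q x v -> acked c q y v -> x = y.
Proof.
move=> rc qb hx hy.
elim: rc x y v hx hy => [|c1 c2 rc1 IH st] x y v hx hy; first by case: hx.
have fresh z : cur_view (local c1 q) = v -> ~~ accepted (local c1 q) ->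
    ~ acked c1 q z v.
  move=> pv na /(reachable_ack rc1 qb) [_ _ acc _].
  by rewrite acc in na.
have [[r sx] [r' sy]] := (hx, hy).
have [ox|[pv na _ _ [sg [tau [_ [ex _ _]]]]]] := step_ack st qb sx.
  have [oy|[pv na _ _ _]] := step_ack st qb sy.
    by apply: (IH x y v); [exists r | exists r'].
  by case: (fresh x pv na); exists r.
have [oy|[_ _ _ _ [sg' [tau' [_ [ey _ _]]]]]] := step_ack st qb sy.
  by case: (fresh y pv na); exists r'.
(* If both acknowledgements are sent in this step, the single stored vote fixes both values. *)
by move: ex; rewrite ey => -[].
Qed.

(** Signing a vote for view [w] means having entered [w], so acknowledgements in earlier views all
    precede the vote. *)
Lemma reachable_signed_vote c q ot w : reachable c -> q \notin byz ->
  signed_votes c (Sign q (ot, w)) ->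
  w <= cur_view (local c q) /\
  forall x v, v < w -> acked c q x v -> remembers x v ot.
Proof.
move=> rc qb; elim: rc ot w => [//|c1 c2 rc1 IH st] ot w hs.
have [old|[-> lt vw]] := step_signed_vote st hs.
  have [le rem] := IH _ _ old; split.
    by case: (step_local q st) => [|[->]]; lia.
  move=> x v vw [r /(step_ack st qb) [sx|[]]]; last by lia.
  by apply: rem => //; exists r.
split; first by rewrite vw.
move=> x v v_w [r /(step_ack st qb) [sx|[_ _ _ [vq _] _]]]; last by lia.
by have [] := reachable_ack rc1 qb (ex_intro _ r sx).
Qed.

(** The second alternative covers processes whose acknowledgement is still to come, so that a quorum
    can be fixed before all of it has acknowledged. *)
Definition may_ack (c : @config n V) q x v : Prop :=
  acked c q x v \/
  (cur_view (local c q) <= v /\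
   (cur_view (local c q) = v -> ~~ accepted (local c q))).

Lemma step_may_ack c c' q x v : step c c' -> q \notin byz ->
  may_ack c' q x v -> may_ack c q x v.
Proof.
move=> st qb [[r /(step_ack st qb) [sx|[vq na _ _ _]]]|[le na]].
- by left; exists r.
- by right; rewrite vq.
- right; case: (step_local q st) => [lt|[eqv acc _]]; first by split; lia.
  by rewrite eqv in le na; split=> // /na; apply: contra.
Qed.

Lemma selection_collection w (C : seq (signed_vote n V)) o :
  selection f w C o -> valid_collection f w C.
Proof. by case. Qed.

(** * Certificates and agreement *)

Context (hf : 1 <= f) (hn : 5 * f - 1 <= n) (hbyz : #|byz| <= f).

Lemma genuine_cert_signer c sg x v :
  genuine c (cert_sigs sg) -> valid_cert f sg x v -> 1 < v ->
  exists2 q, q \notin byz & signed_claims c (Sign q (CertAck x v)).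
Proof.
case: sg => [s|] gs vc v1; last by rewrite (eqP vc) in v1.
have [q qb qs] := cert_correct_signer hbyz vc.
by exists q => //; case: (gs _ qs) => //= qB; rewrite qB in qb.
Qed.

Lemma reachable_ack_cert c q x v : reachable c -> q \notin byz ->
  acked c q x v -> 1 < v ->
  exists2 p, p \notin byz & signed_claims c (Sign p (CertAck x v)).
Proof.
move=> rc qb + v1; elim: rc => [|c1 c2 rc1 IH st] [r]; first by [].
case/(step_ack st qb) => [old|[_ _ _ _ [sg [tau [r' [_ vc rcv]]]]]].
  have [|p pb ps] := IH; first by exists r.
  by exists p => //; apply: step_signed_claims st ps.
have auth := reachable_authentic rc1.
have [gp _] := auth_sent auth (auth_received auth rcv).
have [|p pb ps] := genuine_cert_signer (c := c1) _ vc v1.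
  by move=> t ts; apply: gp; rewrite inE ts orbT.
by exists p => //; apply: step_signed_claims st ps.
Qed.

(** Valid votes carry the leader's signature on their values, and a correct leader signs at most one
    proposal per view. *)
Lemma equivocating_leader_byz c v (C : seq (signed_vote n V)) :
  reachable c -> {in C, forall s, genuine c (opt_vote_sigs (content s).1)} ->
  {in C, forall s, valid_vote f (content s).1} ->
  equivocation C v -> exists2 l, l \in byz & leads l v.
Proof.
move=> rc gC vC [a [b [/eqP ab ha hb]]].
have proposer z : has (votes_for z v) C -> exists2 l, leads l v &
    l \in byz \/ signed_claims c (Sign l (Propose z v)).
  case/hasP=> s sC /votes_forP [t [st <- <-]].
  have := gC s sC; have := vC s sC; rewrite st => /andP [_ /andP [lt /eqP ct]] gt.
  exists (signer (vote_sig t)) => //; rewrite -ct.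
  by have := gt _ (mem_head _ _); case: (vote_sig t).
have [[l lv [lb|la]] [l' l'v [l'b|l'b]]] := (proposer a ha, proposer b hb).
- by exists l.
- by exists l.
- by exists l'.
have ll : l' = l by apply/val_inj; rewrite (eqP lv) (eqP l'v).
by rewrite ll in l'b; case: ab; apply: reachable_propose_inj la l'b.
Qed.

(* [may_ack] is only lost along an execution, so a quorum that has acknowledged
   [x] in [v] at some point locks [x] already at every earlier point.  The
   induction is on time because an induction on views would fail: among the votes
   collected for view [w], a Byzantine one may be for a view above [w]. *)
Lemma certified_value_locked c (Q : {set 'I_n}) x v :
  reachable c -> n - f <= #|Q| -> 0 < v ->
  {in Q, forall q, q \notin byz -> may_ack c q x v} ->
  forall p y w, p \notin byz -> v < w ->
  signed_claims c (Sign p (CertAck y w)) -> y = x.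
Proof.
move=> rc hQ v0; elim: rc => [//|c1 c2 rc1 IH st] hA p y w pb vw hs.
have hA1 : {in Q, forall q, q \notin byz -> may_ack c1 q x v}.
  by move=> q qQ qb; apply: step_may_ack st qb (hA q qQ qb).
have {}IH := IH hA1.
have [old|[r [C [_ rcv out]]]] := step_cert_ack st hs; first exact: IH old.
have auth := reachable_authentic rc1.
have [/= gC gV] := auth_sent auth (auth_received auth rcv).
have gvote : {in C, forall s, genuine c1 (opt_vote_sigs (content s).1)}.
  by move=> s sC t ts; apply: gC; apply/flattenP;
    exists (opt_vote_sigs (content s).1) => //; apply: map_f.
have [vC wC] : {in C, forall s, valid_vote f (content s).1} /\
    {in C, forall s, (content s).2 = w}.
  by case: out => /selection_collection [vC _]; split=> s /vC [].
have later : {in C, forall s t, (content s).1 = Some t ->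
    v < vote_view t -> vote_value t = x}.
  move=> s sC t st' vt; have gt := gvote s sC; have vt' := vC s sC.
  rewrite st' in gt vt'; case/andP: vt' => vc _.
  (* The certificate of a vote has a correct signer who signed before this step, so the induction on
     time covers it whatever its view. *)
  have [|q qb] := genuine_cert_signer (c := c1) _ vc (leq_ltn_trans v0 vt).
    by move=> u us; apply: gt; rewrite inE us orbT.
  exact: IH.
have ackers : {in C, forall s, signer s \in Q -> signer s \notin byz ->
    remembers x v (content s).1}.
  move=> s sC sQ sb; case: (gV s sC) => [sB|]; first by rewrite sB in sb.
  have := wC s sC; case: s sQ sb {sC} => q [ot w'] /= qQ qb -> sv.
  have [le rem] := reachable_signed_vote rc1 qb sv.
  (* Having signed a vote for [w], the process is past [v], so its acknowledgement has already been
     sent. *)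
  case: (hA1 q qQ qb) => [|[]]; last by lia.
  exact: rem.
have locked o := locked_selection (o := o) hf hn hbyz hQ later ackers
  (equivocating_leader_byz rc1 gvote vC (v := v)).
by case: out => /locked [].
Qed.

(** In equal views, a correct process of both quorums acknowledged only one value; if [v < w], its
    acknowledgement of [y] rests on a certificate, which is locked to [x]. *)
Lemma decided_value_locked c x y v w (Q S : {set 'I_n}) : reachable c ->
  n - f <= #|Q| -> {in Q, forall q, acked c q x v} ->
  n - f <= #|S| -> {in S, forall q, acked c q y w} -> v <= w -> y = x.
Proof.
move=> rc hQ aQ hS aS; have [q [qQ qS qb]] := quorums_meet_correct hf hn hbyz hQ hS.
have [qx qy] := (aQ q qQ, aS q qS).
rewrite leq_eqVlt => /orP [/eqP vw|vw].
  by subst w; apply: reachable_ack_inj rc qb qy qx.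
have [v0 _ _ _] := reachable_ack rc qb qx.
have [p pb ps] := reachable_ack_cert rc qb qy (leq_ltn_trans v0 vw).
by apply: (certified_value_locked rc hQ v0 _ pb vw ps) => u uQ _; left; apply: aQ.
Qed.

Lemma decides_acked c p x : reachable c -> decides f c p x ->
  exists v (Q : {set 'I_n}), n - f <= #|Q| /\ {in Q, forall q, acked c q x v}.
Proof.
move=> rc [v [Q [hQ hr]]]; exists v, Q; split=> // q /hr rcv.
by exists p; apply: (auth_received (reachable_authentic rc)).
Qed.

End Executions.

Theorem theorem3p6 (n f : nat) (V : eqType) (byz : {set 'I_n})
    (input : 'I_n -> V) (hf : 1 <= f) (hn : 5 * f - 1 <= n)
    (hbyz : #|byz| <= f) :
  consistency f byz input.
Proof.
move=> c rc p q x y _ _ /(decides_acked rc) [v [Q [hQ aQ]]].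
move=> /(decides_acked rc) [w [S [hS aS]]].
have [vw|wv] := leqP v w.
  by apply/esym; apply: decided_value_locked rc hQ aQ hS aS vw.
by apply: decided_value_locked rc hS aS hQ aQ (ltnW wv).
Qed.
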